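(* Let $A\in\mathbb{R}^{n\times n}$, $B\in\mathbb{R}^{n\times m}$, $C\in\mathbb{R}^{p\times n}$, let $T\ge n$, and let $X_0\in\mathbb{R}^{n\times N}$, $U\in\mathbb{R}^{mT\times N}$, $Y\in\mathbb{R}^{pT\times N}$ be the initial-state, input and output data matrices of $N$ experiments of horizon $T$ on the system $x(t+1)=Ax(t)+Bu(t)$, $y(t)=Cx(t)$. Assume the data are persistently exciting, i.e. $\operatorname{rank}\begin{bmatrix}X_0 \\ U\end{bmatrix}=n+mT$. Let $K_0$ and $K_U$ be matrices whose columns form bases of $\operatorname{Ker}(X_0)$ and $\operatorname{Ker}(U)$, respectively. Then the largest $(A,\operatorname{Im}(B))$-controlled invariant subspace $\mathcal{V}^*$ contained in $\operatorname{Ker}(C)$ is $$\mathcal{V}^*=\begin{bmatrix}X_0K_U & 0\end{bmatrix}\operatorname{Ker}\begin{bmatrix}YK_U & YK_0\end{bmatrix}.$$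
   Context: A subspace $\mathcal{V}\subseteq\mathbb{R}^n$ is $(A,\operatorname{Im}(B))$-controlled invariant if $A\mathcal{V}\subseteq\mathcal{V}+\operatorname{Im}(B)$. $\mathcal{V}^*$ denotes the largest such subspace contained in $\operatorname{Ker}(C)$. Data: for $i=1,\dots,N$, the system is run from initial state $x_0^i\in\mathbb{R}^n$ with inputs $u^i(0),\dots,u^i(T-1)\in\mathbb{R}^m$, giving states $x^i(t)$ and outputs $y^i(t)=Cx^i(t)$. Set $U_T^i=[u^i(0)^\top\cdots u^i(T-1)^\top]^\top$ and $Y_T^i=[y^i(0)^\top\cdots y^i(T-1)^\top]^\top$. Then $X_0=[x_0^1\cdots x_0^N]$, $U=[U_T^1\cdots U_T^N]$, $Y=[Y_T^1\cdots Y_T^N]$. For a matrix $M$ and a subspace $\mathcal{W}$, $M\mathcal{W}=\{Mw: w\in\mathcal{W}\}$. The zero block in $[X_0K_U\ \ 0]$ has as many columns as $K_0$. *)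

(* Defs.v *)
From HB Require Import structures.
From mathcomp Require Import all_boot all_order all_algebra.
From mathcomp Require Import reals.
Set Implicit Arguments.
Unset Strict Implicit.
Unset Printing Implicit Defensive.
Import GRing.Theory.
Local Open Scope ring_scope.

(* Subspaces of R^n are {vspace 'cV[R]_n}; a matrix acts on column vectors by
   left multiplication. *)
Definition mxhom (R : realType) (q r : nat) (M : 'M[R]_(q, r)) :
  'Hom('cV[R]_r, 'cV[R]_q) := linfun (mulmx M).

Definition Ker (R : realType) (q r : nat) (M : 'M[R]_(q, r)) :
  {vspace 'cV[R]_r} := lker (mxhom M).

Definition Im (R : realType) (q r : nat) (M : 'M[R]_(q, r)) :
  {vspace 'cV[R]_q} := limg (mxhom M).

Definition mximg (R : realType) (q r : nat) (M : 'M[R]_(q, r))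
  (W : {vspace 'cV[R]_r}) : {vspace 'cV[R]_q} := (mxhom M @: W)%VS.

Definition columns_basis (R : realType) (q k : nat) (K : 'M[R]_(q, k))
  (W : {vspace 'cV[R]_q}) : Prop := basis_of W [seq col j K | j : 'I_k].

Definition controlled_invariant (R : realType) (n m : nat) (A : 'M[R]_n)
  (B : 'M[R]_(n, m)) (V : {vspace 'cV[R]_n}) : Prop :=
  (mximg A V <= V + Im B)%VS.

Definition is_largest_ci_in_Ker (R : realType) (n m p : nat) (A : 'M[R]_n)
  (B : 'M[R]_(n, m)) (C : 'M[R]_(p, n)) (V : {vspace 'cV[R]_n}) : Prop :=
  [/\ controlled_invariant A B V,
      (V <= Ker C)%VS &
      forall W : {vspace 'cV[R]_n},
        controlled_invariant A B W -> (W <= Ker C)%VS -> (W <= V)%VS].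

Fixpoint state (R : realType) (n m : nat) (A : 'M[R]_n) (B : 'M[R]_(n, m))
  (x0 : 'cV[R]_n) (u : nat -> 'cV[R]_m) (t : nat) : 'cV[R]_n :=
  if t is s.+1 then A *m state A B x0 u s + B *m u s else x0.

Definition output (R : realType) (n m p : nat) (A : 'M[R]_n)
  (B : 'M[R]_(n, m)) (C : 'M[R]_(p, n)) (x0 : 'cV[R]_n)
  (u : nat -> 'cV[R]_m) (t : nat) : 'cV[R]_p := C *m state A B x0 u t.

(* [v 0 ... v (N-1)] *)
Definition columns (R : realType) (q N : nat) (v : 'I_N -> 'cV[R]_q) :
  'M[R]_(q, N) := \matrix_(r, i) v i r 0.

(* [w(0)^T ... w(T-1)^T]^T; its height \sum_(t < T) q is q * T, in the form
   produced by \mxcol.  Values w t with t >= T are ignored. *)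
Definition stack (R : realType) (q T : nat) (w : nat -> 'cV[R]_q) :
  'cV[R]_(\sum_(t < T) q) := \mxcol_(t < T) w t.

(* Main.v *)
(* By persistency of excitation, right multiplication of the data by g : R^N
   reaches every pair (initial state, input sequence), and Y g is the output of
   the trajectory so reached.  Splitting g into g_U + g_0 with U g_U = 0 and
   X0 g_0 = 0 shows that the right-hand side is the set of initial states from
   which some input keeps the output zero for T steps.  This set is the T-th
   term of the decreasing recursion S_0 = R^n,
   S_(k+1) = {x in Ker C | A x in S_k + Im B}, which is stationary from k = n
   on, with limit V*. *)
Require Import Defs.
From HB Require Import structures.
From mathcomp Require Import all_boot all_order all_algebra.
From mathcomp Require Import reals.
Set Implicit Arguments.
Unset Strict Implicit.
Unset Printing Implicit Defensive.
Import GRing.Theory.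
Local Open Scope ring_scope.

Section Subspaces.
Variable R : realType.

Lemma mxhomE (q r : nat) (M : 'M[R]_(q, r)) (x : 'cV[R]_r) :
  mxhom M x = M *m x.
Proof. by rewrite /mxhom lfunE. Qed.

Lemma mem_Ker (q r : nat) (M : 'M[R]_(q, r)) (x : 'cV[R]_r) :
  (x \in Ker M) = (M *m x == 0).
Proof. by rewrite /Ker memv_ker mxhomE. Qed.

Lemma mximgP (q r : nat) (M : 'M[R]_(q, r)) (W : {vspace 'cV[R]_r})
    (y : 'cV[R]_q) :
  reflect (exists2 x, x \in W & y = M *m x) (y \in mximg M W).
Proof.
apply: (iffP memv_imgP) => -[x xW yE]; exists x => //.
  by rewrite yE mxhomE.
by rewrite mxhomE.
Qed.

Lemma ImP (q r : nat) (M : 'M[R]_(q, r)) (y : 'cV[R]_q) :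
  reflect (exists x, y = M *m x) (y \in Im M).
Proof.
apply: (iffP (mximgP M fullv y)) => [[x _ ->]|[x ->]]; exists x => //.
exact: memvf.
Qed.

Lemma columns_basisP (q k : nat) (K : 'M[R]_(q, k)) (W : {vspace 'cV[R]_q}) :
  columns_basis K W -> W = Im K.
Proof.
move=> /span_basis <-; apply/eqP; rewrite eqEsubv; apply/andP; split.
  apply/span_subvP => _ /mapP[j _ ->]; apply/ImP.
  by exists (delta_mx j 0); rewrite colE.
apply/subvP => _ /ImP[a ->].
have -> : K *m a = \sum_j a j 0 *: col j K.
  apply/colP => i; rewrite mxE summxE; apply: eq_bigr => j _.
  by rewrite !mxE mulrC.
apply: rpred_sum => j _; apply: rpredZ; apply: memv_span.
by apply: map_f; rewrite mem_enum.
Qed.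

End Subspaces.

Section ControlledInvariance.
Variables (R : realType) (n m p : nat).
Variables (A : 'M[R]_n) (B : 'M[R]_(n, m)) (C : 'M[R]_(p, n)).

Definition ci_step (V : {vspace 'cV[R]_n}) : {vspace 'cV[R]_n} :=
  (Ker C :&: (mxhom A @^-1: (V + Im B)))%VS.

Definition ci_iter (k : nat) : {vspace 'cV[R]_n} := iter k ci_step fullv.

Lemma ci_stepS (V W : {vspace 'cV[R]_n}) :
  (V <= W)%VS -> (ci_step V <= ci_step W)%VS.
Proof. by move=> VW; apply: capvS => //; apply/lpreimS/addvS. Qed.

Lemma mem_ci_step (V : {vspace 'cV[R]_n}) (x : 'cV[R]_n) :
  (x \in ci_step V) = (C *m x == 0) && (A *m x \in (V + Im B)%VS).
Proof. by rewrite memv_cap mem_Ker -memv_preim mxhomE. Qed.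

(** This turns the search for V* into an order problem: V* is the greatest post-fixed point of the
    monotone operator [ci_step]. *)
Lemma sub_ci_step (W : {vspace 'cV[R]_n}) :
  (W <= ci_step W)%VS <-> controlled_invariant A B W /\ (W <= Ker C)%VS.
Proof.
split=> [/subvP sW|[/subvP ciW /subvP WC]].
  split; apply/subvP => x.
    by move=> /mximgP[w /sW + ->]; rewrite mem_ci_step => /andP[].
  by move=> /sW; rewrite mem_ci_step mem_Ker => /andP[].
apply/subvP => x xW; rewrite mem_ci_step -mem_Ker WC //=.
by apply: ciW; apply/mximgP; exists x.
Qed.

Lemma ci_iter_decr (k : nat) : (ci_iter k.+1 <= ci_iter k)%VS.
Proof. by elim: k => [|k IHk]; [exact: subvf | exact: ci_stepS]. Qed.

(** Each strict inclusion in the decreasing chain costs at least one dimension, starting from n, and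
    an equality of two consecutive terms is passed on by [ci_step] to all later ones. *)
Lemma ci_iter_dim_or_fix (k : nat) :
  (\dim (ci_iter k) + k <= n)%N \/ ci_iter k.+1 = ci_iter k.
Proof.
elim: k => [|k [IHk|IHk]].
- by left; rewrite addn0 dimvf dim_matrix mulr1.
- have [E|neq] := eqVneq (ci_iter k.+1) (ci_iter k).
    by right; rewrite [LHS]/(ci_step (ci_iter k.+1)) E.
  left; rewrite addnS; apply: leq_trans IHk; rewrite ltn_add2r ltnNge.
  by apply: contra neq => ledim; rewrite eqEdim ci_iter_decr.
- by right; rewrite [LHS]/(ci_step (ci_iter k.+1)) IHk.
Qed.

Lemma ci_iter_fix (k : nat) : (n <= k)%N -> ci_iter k.+1 = ci_iter k.
Proof.
move=> le_nk; have [le_dim|//] := ci_iter_dim_or_fix k.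
(* If the chain has been strict so far, n steps have used up all dimensions, so the term is 0 and
   cannot shrink further. *)
have : (\dim (ci_iter k) + k <= 0 + k)%N by apply: leq_trans le_dim _.
rewrite leq_add2r leqn0 dimv_eq0 => /eqP S0; apply/eqP.
by have := ci_iter_decr k; rewrite S0 subv0.
Qed.

Lemma ci_iter_largest (k : nat) :
  (n <= k)%N -> is_largest_ci_in_Ker A B C (ci_iter k).
Proof.
move=> /ci_iter_fix fixk.
have [|ci inK] := (sub_ci_step (ci_iter k)).1.
  by rewrite -[ci_step _]/(ci_iter k.+1) fixk.
(* Maximality needs no stationarity: by monotonicity such a W lies below every iterate. *)
split=> // W ciW WC; elim: k {fixk ci inK} => [|k IHk]; first exact: subvf.
have /subv_trans : (W <= ci_step W)%VS by apply/sub_ci_step.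
by apply; apply: ci_stepS.
Qed.

Lemma is_largest_ci_unique (V W : {vspace 'cV[R]_n}) :
  is_largest_ci_in_Ker A B C V -> is_largest_ci_in_Ker A B C W -> V = W.
Proof.
move=> [ciV VC maxV] [ciW WC maxW]; apply/eqP.
by rewrite eqEsubv maxW ?maxV.
Qed.

(** [state] unfolds at the last input, whereas the subspace recursion consumes the first one. *)
Lemma state_shift (x : 'cV[R]_n) (u : nat -> 'cV[R]_m) (t : nat) :
  state A B x u t.+1 = state A B (A *m x + B *m u 0) (fun s => u s.+1) t.
Proof. by elim: t => //= t <-. Qed.

Lemma eq_state (x : 'cV[R]_n) (u v : nat -> 'cV[R]_m) (t : nat) :
  (forall s, (s < t)%N -> u s = v s) -> state A B x u t = state A B x v t.
Proof.
elim: t => //= t IHt uv; rewrite uv // IHt // => s st.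
by apply: uv; apply: leqW.
Qed.

Lemma ci_iterP (k : nat) (x : 'cV[R]_n) :
  x \in ci_iter k <->
  exists u, forall t, (t < k)%N -> output A B C x u t = 0.
Proof.
elim: k x => [|k IHk] x.
  by split=> [_|_]; [exists (fun=> 0) | exact: memvf].
rewrite [ci_iter _]/(ci_step (ci_iter k)) mem_ci_step; split.
  move=> /andP[/eqP Cx /memv_addP[y /IHk[u yu] [_ /ImP[w ->] Ax]]].
  (* Since A x = y + B w, the first input -w steers x to y, from which [u] keeps the output zero. *)
  exists (fun t => if t is s.+1 then u s else - w) => -[|t] // lt_tk.
  by rewrite /output state_shift Ax mulmxN addrK; apply: yu.
move=> [u xu]; rewrite -[C *m x]/(output A B C x u 0) xu // eqxx /=.
(* Here A x is split as the next state, which lies in S_k by induction, plus B(-u(0)). *)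
rewrite -[A *m x](addrK (B *m u 0)) -mulmxN memv_add //.
  apply/IHk; exists (fun s => u s.+1) => t tk.
  by rewrite -(xu t.+1) // /output state_shift.
by apply/ImP; eexists.
Qed.

Lemma state_sum (N : nat) (g : 'cV[R]_N) (x : 'I_N -> 'cV[R]_n)
    (u : 'I_N -> nat -> 'cV[R]_m) (t : nat) :
  state A B (\sum_i g i 0 *: x i) (fun s => \sum_i g i 0 *: u i s) t =
  \sum_i g i 0 *: state A B (x i) (u i) t.
Proof.
elim: t => //= t ->; rewrite !mulmx_sumr -big_split; apply: eq_bigr => i _ /=.
by rewrite scalerDr !scalemxAr.
Qed.

Lemma output_sum (N : nat) (g : 'cV[R]_N) (x : 'I_N -> 'cV[R]_n)
    (u : 'I_N -> nat -> 'cV[R]_m) (t : nat) :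
  output A B C (\sum_i g i 0 *: x i) (fun s => \sum_i g i 0 *: u i s) t =
  \sum_i g i 0 *: output A B C (x i) (u i) t.
Proof.
rewrite /output state_sum mulmx_sumr; apply: eq_bigr => i _.
by rewrite scalemxAr.
Qed.

End ControlledInvariance.

Section DataMatrices.
Variable R : realType.

Lemma columns_mul (q N : nat) (v : 'I_N -> 'cV[R]_q) (g : 'cV[R]_N) :
  columns v *m g = \sum_i g i 0 *: v i.
Proof.
apply/colP => r; rewrite mxE summxE; apply: eq_bigr => i _.
by rewrite !mxE mulrC.
Qed.

Lemma stack_sum (q T N : nat) (g : 'cV[R]_N) (w : 'I_N -> nat -> 'cV[R]_q) :
  \sum_i g i 0 *: stack T (w i) = stack T (fun t => \sum_i g i 0 *: w i t).
Proof.
apply/colP => r; rewrite summxE !mxE summxE; apply: eq_bigr => i _.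
by rewrite !mxE.
Qed.

Lemma eq_stackP (q T : nat) (v w : nat -> 'cV[R]_q) :
  stack T v = stack T w <-> (forall t, (t < T)%N -> v t = w t).
Proof.
rewrite /stack; split=> [/eq_mxcolP vw t tT|vw].
  exact: (vw (Ordinal tT)).
by apply/eq_mxcolP => t; apply: vw.
Qed.

Lemma stack_eq0 (q T : nat) (w : nat -> 'cV[R]_q) :
  stack T w = 0 <-> (forall t, (t < T)%N -> w t = 0).
Proof.
have -> : 0 = stack T (fun=> 0 : 'cV[R]_q) by apply/colP => r; rewrite !mxE.
exact: eq_stackP.
Qed.

Lemma row_free_surj (q r : nat) (M : 'M[R]_(q, r)) (y : 'cV[R]_q) :
  row_free M -> exists x, M *m x = y.
Proof.
by move=> /row_freeP[D MD]; exists (D *m y); rewrite mulmxA MD mul1mx.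
Qed.

End DataMatrices.

Theorem mainTheorem1 (R : realType) (n m p T N : nat)
  (A : 'M[R]_n) (B : 'M[R]_(n, m)) (C : 'M[R]_(p, n))
  (hT : (n <= T)%N)
  (x0 : 'I_N -> 'cV[R]_n) (u : 'I_N -> nat -> 'cV[R]_m)
  (X0 : 'M[R]_(n, N))
  (U : 'M[R]_(\sum_(t < T) m, N))
  (Y : 'M[R]_(\sum_(t < T) p, N))
  (hX0 : X0 = columns x0)
  (hU : U = columns (fun i => stack T (u i)))
  (hY : Y = columns (fun i => stack T (output A B C (x0 i) (u i))))
  (hPE : \rank (col_mx X0 U) = (n + m * T)%N)
  (k0 kU : nat) (K0 : 'M[R]_(N, k0)) (KU : 'M[R]_(N, kU))
  (hK0 : columns_basis K0 (Ker X0)) (hKU : columns_basis KU (Ker U)) :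
  forall V : {vspace 'cV[R]_n},
    is_largest_ci_in_Ker A B C V <->
    V = mximg (row_mx (X0 *m KU) (0 : 'M[R]_(n, k0)))
              (Ker (row_mx (Y *m KU) (Y *m K0))).
Proof.
set Vd := mximg _ _.
have Yg g : Y *m g = stack T (output A B C (X0 *m g)
    (fun t => \sum_i g i 0 *: u i t)).
  rewrite hY hX0 !columns_mul stack_sum; apply/eq_stackP => t _.
  by rewrite output_sum.
have Ug g : U *m g = stack T (fun t => \sum_i g i 0 *: u i t).
  by rewrite hU columns_mul stack_sum.
(* The stacked data matrix has exactly n + mT rows, so persistency of excitation is full row
   rank. *)
have free : row_free (col_mx X0 U).
  by rewrite /row_free hPE sum_nat_const card_ord mulnC.
have reach (x : 'cV_n) w : exists g, X0 *m g = x /\ U *m g = w.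
  have [g] := row_free_surj (col_mx x w) free.
  by rewrite mul_col_mx => /eq_col_mx[? ?]; exists g.
have -> : Vd = ci_iter A B C T.
  apply/vspaceP => x; apply/idP/idP.
    move=> /mximgP[ab]; rewrite -[ab]vsubmxK mem_Ker !mul_row_col mul0mx addr0.
    set a := usubmx ab; set b := dsubmx ab => /eqP Yab ->.
    have X0K0b : X0 *m (K0 *m b) = 0.
      apply/eqP; rewrite -mem_Ker (columns_basisP hK0).
      by apply/ImP; exists b.
    (* Adding K0 b leaves the initial state unchanged, and the combined experiment has output Y(KU a
       + K0 b) = 0. *)
    have -> : X0 *m KU *m a = X0 *m (KU *m a + K0 *m b).
      by rewrite mulmxDr X0K0b addr0 mulmxA.
    apply/ci_iterP; exists (fun t => \sum_i (KU *m a + K0 *m b) i 0 *: u i t).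
    by apply/stack_eq0; rewrite -Yg mulmxDr !mulmxA.
  move=> /ci_iterP[w xw].
  (* The zero-output trajectory is split by superposition: [g] carries the initial state with zero
     input, [h] the input with zero initial state. *)
  have [g [X0g U0g]] := reach x 0.
  have [h [X0h Uh]] := reach 0 (stack T w).
  have /ImP[a gE] : g \in Im KU by rewrite -(columns_basisP hKU) mem_Ker U0g.
  have /ImP[b hE] : h \in Im K0 by rewrite -(columns_basisP hK0) mem_Ker X0h.
  apply/mximgP; exists (col_mx a b); last first.
    by rewrite mul_row_col mul0mx addr0 -mulmxA -gE.
  rewrite mem_Ker mul_row_col -!mulmxA -gE -hE -mulmxDr Yg.
  apply/eqP/stack_eq0 => t tT; rewrite -(xw t tT) mulmxDr X0g X0h addr0.
  (* The input realised by g + h agrees with [w] only before time T, which suffices for the state at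
     t < T. *)
  rewrite /output; congr (C *m _); apply: eq_state => s st.
  have /eq_stackP : stack T (fun t => \sum_i (g + h) i 0 *: u i t) = stack T w.
    by rewrite -Ug mulmxDr U0g Uh add0r.
  by apply; apply: ltn_trans tT.
have largest := ci_iter_largest A B C hT.
by move=> V; split=> [/is_largest_ci_unique|->//]; apply.
Qed.
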